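(* Let $q$ be a complex number with $0<|q|<1$ and fix a square root $q^{1/2}$ of $q$. Suppose that $(\alpha_n,\beta_n)_{n\ge 0}$ is a Bailey pair relative to $1$ and that there is a sequence $(g_n)_{n\in\mathbb{Z}}$, defined for all integers $n$, with $g_0=1$, $$\alpha_n=\begin{cases}1 & \text{if } n=0,\\ (1+q^n)g_n & \text{if } n\ge 1,\end{cases}$$ and $g_{-n}=q^ng_n$ for all $n\in\mathbb{Z}$. Then for all integers $m\ge 0$ and $1\le a\le m$ (such that the two multiple series on the left and the series on the right below converge absolutely), we have $$\sum_{n_m,\dots,n_1\ge 0}\frac{q^{\frac12(n_m^2+n_{m-1}^2+\cdots+n_1^2)}(-q^{\frac12},q)_{n_1}}{(q)_{n_m}}\,\beta_{n_1}\prod_{i=1}^{m-1}\begin{bmatrix} n_{i+1}+\delta_{a,i}\\ n_i\end{bmatrix}$$ $$-\sum_{n_m,\dots,n_1\ge 0}\frac{q^{\frac12(n_m^2+n_{m-1}^2+\cdots+n_1^2)}(-q^{\frac12},q)_{n_1+\delta_{a-1,0}}}{(q)_{n_m}}\,\beta_{n_1+\delta_{a-1,0}}\prod_{i=1}^{m-1}\begin{bmatrix} n_{i+1}+\delta_{a-1,i}\\ n_i\end{bmatrix}$$ $$=-q^{\frac{a-1}{2}}\,\frac{(-q^{\frac12})_\infty}{(q)_\infty}\sum_{n\in\mathbb{Z}}q^{\frac m2n^2+na-n}g_{n+1}.$$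
   Context: Notation: $(x)_n=(x;q)_n=\prod_{j=0}^{n-1}(1-xq^j)$ for $n\ge 0$, $(x)_\infty=\prod_{j\ge 0}(1-xq^j)$, and $(x,y)_n=(x)_n(y)_n$; thus $(-q^{1/2},q)_n=(-q^{1/2})_n(q)_n$. Half-integer powers of $q$ are powers of the fixed $q^{1/2}$. The $q$-binomial coefficient is $\begin{bmatrix} n\\k\end{bmatrix}=\frac{(q)_n}{(q)_{n-k}(q)_k}$ if $0\le k\le n$, and $0$ otherwise. $\delta_{i,j}$ is the Kronecker delta; empty products equal $1$. A Bailey pair relative to $x$ is a pair of sequences $(\alpha_n,\beta_n)_{n\ge 0}$ satisfying $\beta_n=\sum_{k=0}^n\frac{\alpha_k}{(q)_{n-k}(xq)_{n+k}}$ for all $n\ge 0$. *)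

(* Defs.v *)
From HB Require Import structures.
From mathcomp Require Import all_boot all_order all_algebra.
From mathcomp Require Import complex.
From mathcomp Require Import all_classical all_reals all_analysis.
From mathcomp Require showcase.summability.
Set Implicit Arguments.
Unset Strict Implicit.
Unset Printing Implicit Defensive.
Import Order.TTheory GRing.Theory Num.Theory.
Import numFieldNormedType.Exports.
Local Open Scope classical_set_scope.
Local Open Scope ring_scope.

(* (x; q)_n, with the base q as first argument. *)
Definition qpoch (F : fieldType) (q x : F) (n : nat) : F :=
  \prod_(j < n) (1 - x * q ^+ j).

(* Limits in the complex numbers are taken in R[i]^o, that is, for the topology
   of the modulus. *)
Definition qpoch_inf (R : realType) (q x : R[i]) : R[i] :=
  limn (fun n => qpoch q x n : R[i]^o).

Definition qbinom (F : fieldType) (q : F) (n k : nat) : F :=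
  if (k <= n)%N then qpoch q q n / (qpoch q q (n - k) * qpoch q q k) else 0.

Definition bailey_pair (F : fieldType) (q x : F) (alpha beta : nat -> F) : Prop :=
  forall n : nat, beta n =
    \sum_(k < n.+1) alpha k / (qpoch q q (n - k) * qpoch q (x * q) (n + k)).

Definition abs_summable (R : realType) (I : choiceType) (f : I -> R[i]) : Prop :=
  summable [set: I] (fun i => (ComplexField.Normc.normc (f i))%:E).

(* The limit of the finite partial sums along the directed set of the finite
   subsets of I; it is only meaningful for summable families. *)
Definition csum (R : realType) (I : choiceType) (f : I -> R[i]) : R[i] :=
  summability.sum (f : I -> R[i]^o).

(* The multi-index (n_1, ..., n_m) is a tuple, numbered from 1. *)
Definition nidx (m : nat) (n : m.-tuple nat) (i : nat) : nat := nth 0%N n i.-1.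

(* In the next two definitions s is the chosen square root of q, and the boolean
   equalities coerced to nat are Kronecker deltas. *)
Definition summand1 (F : fieldType) (q s : F) (beta : nat -> F) (m a : nat)
    (n : m.-tuple nat) : F :=
  s ^+ (\sum_(1 <= i < m.+1) nidx n i ^ 2)%N
  * (qpoch q (- s) (nidx n 1) * qpoch q q (nidx n 1))
  / qpoch q q (nidx n m)
  * beta (nidx n 1)
  * \prod_(1 <= i < m) qbinom q (nidx n i.+1 + (a == i))%N (nidx n i).

Definition summand2 (F : fieldType) (q s : F) (beta : nat -> F) (m a : nat)
    (n : m.-tuple nat) : F :=
  s ^+ (\sum_(1 <= i < m.+1) nidx n i ^ 2)%N
  * (qpoch q (- s) (nidx n 1 + (a - 1 == 0))%N
     * qpoch q q (nidx n 1 + (a - 1 == 0))%N)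
  / qpoch q q (nidx n m)
  * beta (nidx n 1 + (a - 1 == 0))%N
  * \prod_(1 <= i < m) qbinom q (nidx n i.+1 + (a - 1 == i))%N (nidx n i).

(* q^{(m/2) n^2 + n a - n} g_{n+1}, the power of q being a power of s. *)
Definition summand3 (F : fieldType) (s : F) (g : int -> F) (m a : nat)
    (n : int) : F :=
  s ^ (m%:Z * n ^+ 2 + 2 * (n * a%:Z - n)) * g (n + 1).

(* Main.v *)
(* Replacing the missing index n_{m+1} = oo by a finite M turns both multiple
   series into finite sums.  Writing
     beta_n = sum_{|k| <= n} g_k U(n, k),   U(n, k) = 1 / ((q)_{n-k} (q)_{n+k}),
   the q-Chu-Vandermonde sum shows that summing over one index n_i multiplies the
   coefficient of (-q^{1/2}, q)_n U(n, k) by q^{k^2/2}; this evaluates all the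
   sums except the one at which the two series differ.  There the difference of
   the two series is, up to a function odd in k, a combination of the kernels
   U(n, k - 1) instead of U(n + 1, k); the odd part vanishes because
   g_{-k} = q^k g_k.  This gives an exact identity for every M, in which each of
   the three sums has its general term multiplied by a factor that is bounded in
   M and convergent, so M -> oo by Tannery's theorem. *)
Require Import Defs.
From HB Require Import structures.
From mathcomp Require Import all_boot all_order all_algebra.
From mathcomp Require Import complex.
From mathcomp Require Import all_classical all_reals all_analysis.
From mathcomp Require Import finmap zify ring lra.
Set Implicit Arguments.
Unset Strict Implicit.
Unset Printing Implicit Defensive.
Import Order.TTheory GRing.Theory Num.Theory.
Import numFieldNormedType.Exports.
Local Open Scope ring_scope.

(** * The finite identity *)

Section FiniteIdentities.
Variables (F : fieldType) (q : F).

(** * q-shifted factorials and the q-Chu-Vandermonde sum *)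

Lemma qpoch0 x : qpoch q x 0 = 1.
Proof. by rewrite /qpoch big_ord0. Qed.

Lemma qpochSr x n : qpoch q x n.+1 = qpoch q x n * (1 - x * q ^+ n).
Proof. by rewrite /qpoch big_ord_recr. Qed.

Lemma qpochD x m n : qpoch q x (m + n) = qpoch q x m * qpoch q (x * q ^+ m) n.
Proof.
elim: n => [|n IHn]; first by rewrite addn0 qpoch0 mulr1.
by rewrite addnS !qpochSr IHn exprD !mulrA.
Qed.

Lemma qpochS x n : qpoch q x n.+1 = (1 - x) * qpoch q (x * q) n.
Proof. by rewrite -add1n qpochD qpochSr qpoch0 mul1r expr1 expr0 mulr1. Qed.

Lemma qbinom_small n k : (n < k)%N -> qbinom q n k = 0.
Proof. by rewrite ltnNge /qbinom => /negbTE ->. Qed.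

Hypothesis q_neq0 : q != 0.
Hypothesis qfact_neq0 : forall n, qpoch q q n != 0.

Lemma qbinom0 n : qbinom q n 0 = 1.
Proof. by rewrite /qbinom leq0n subn0 qpoch0 mulr1 divff. Qed.

Lemma one_sub_expr_neq0 n : 1 - q ^+ n.+1 != 0.
Proof.
by have := qfact_neq0 n.+1; rewrite qpochSr mulf_eq0 negb_or -exprS => /andP[].
Qed.

Lemma qbinomS n r : (r <= n)%N ->
  qbinom q n.+1 r.+1 = qbinom q n r.+1 + q ^+ (n - r) * qbinom q n r.
Proof.
move=> le_rn; rewrite /qbinom ltnS le_rn subSS; case: ltnP => [lt_rn|le_nr].
  have [d ->] : exists d, n = (r + d.+1)%N by exists (n - r.+1)%N; lia.
  rewrite addKn.
  have -> : (r + d.+1 - r.+1 = d)%N by lia.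
  rewrite [qpoch q q (_ + _).+1]qpochSr; move: (qpoch q q (r + d.+1)) => w.
  rewrite !qpochSr exprD !exprS.
  have := (qfact_neq0 d, qfact_neq0 r, one_sub_expr_neq0 d, one_sub_expr_neq0 r).
  by rewrite !exprS => -[[[d0 r0] Sd0] Sr0]; field; rewrite d0 r0 Sd0 Sr0.
have -> : r = n by apply/eqP; rewrite eqn_leq le_rn le_nr.
by rewrite subnn qpoch0 expr0 !mul1r add0r !divff.
Qed.

(* The q-Chu-Vandermonde sum with the denominators (be)_r cleared. *)
Lemma q_chu_vandermonde n b e :
  \sum_(r < n.+1) qbinom q n r * (- e) ^+ r * q ^+ 'C(r, 2) * qpoch q b r
     * qpoch q (b * e * q ^+ r) (n - r) = qpoch q e n.
Proof.
elim: n b => [|n IHn] b.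
  by rewrite big_ord1 bin0n qbinom0 !expr0 subnn !qpoch0 !mul1r.
pose X r := (- e) ^+ r * q ^+ 'C(r, 2) * qpoch q b r
     * qpoch q (b * e * q ^+ r) (n.+1 - r).
(* The q-Pascal rule splits the sum for n + 1 in two; the induction hypothesis evaluates the first
   half with b and the second with b q. *)
transitivity (\sum_(r < n.+1) qbinom q n r * X r
   + \sum_(r < n.+1) q ^+ (n - r) * qbinom q n r * X r.+1).
  have -> : \sum_(r < n.+1) qbinom q n r * X r
          = \sum_(r < n.+2) qbinom q n r * X r.
    by rewrite [RHS]big_ord_recr /= (qbinom_small (ltnSn n)) mul0r addr0.
  rewrite big_ord_recl [X in _ = X + _]big_ord_recl -addrA -big_split /=.
  rewrite !qbinom0 /X !mulrA; congr (_ + _); apply: eq_bigr => i _.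
  rewrite /bump leq0n add1n qbinomS; last by rewrite -ltnS.
  by rewrite !mulrDl !mulrA.
have -> : \sum_(r < n.+1) qbinom q n r * X r
        = (1 - b * e * q ^+ n) * qpoch q e n.
  rewrite -(IHn b) mulr_sumr; apply: eq_bigr => -[r /=]; rewrite ltnS => le_rn _.
  rewrite /X subSn // qpochSr -[_ * q ^+ r * q ^+ _]mulrA -exprD subnKC //.
  by ring.
have -> : \sum_(r < n.+1) q ^+ (n - r) * qbinom q n r * X r.+1
        = - e * q ^+ n * (1 - b) * qpoch q e n.
  rewrite -(IHn (b * q)) mulr_sumr; apply: eq_bigr => -[r /=].
  rewrite ltnS => le_rn _; rewrite /X subSS qpochS binS bin1 exprD exprS.
  rewrite [q ^+ r.+1]exprS.
  have -> : b * q * e * q ^+ r = b * e * (q * q ^+ r) by ring.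
  have -> : q ^+ n = q ^+ r * q ^+ (n - r) by rewrite -exprD subnKC.
  by ring.
by rewrite qpochSr; ring.
Qed.

(** * The kernels U(n, k) and their behaviour under one summation *)

Definition qfactinv (z : int) : F := if z is Posz n then (qpoch q q n)^-1 else 0.

(** The convention 1/(q)_z = 0 for z < 0 makes this recurrence valid on all of Z: at z = 0 the
    factor 1 - q^z vanishes. *)
Lemma qfactinv_pred z : qfactinv (z - 1) = (1 - q ^ z) * qfactinv z.
Proof.
case: z => [[|n]|n]; first by rewrite expr0z subrr mul0r.
  have -> : n.+1%:Z - 1 = n%:Z by lia.
  by rewrite /= qpochSr -exprS -exprnP invfM mulrCA mulfV ?mulr1 ?one_sub_expr_neq0.
have -> : Negz n - 1 = Negz n.+1 by lia.
by rewrite /= mulr0.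
Qed.

Lemma qfactinv_lt0 z : z < 0 -> qfactinv z = 0.
Proof. by case: z. Qed.

Lemma qbinomE n k :
  qbinom q n k = qpoch q q n * qfactinv (n%:Z - k%:Z) / qpoch q q k.
Proof.
rewrite /qbinom; case: leqP => [le_kn|lt_nk].
  by rewrite subzn //= invfM mulrA.
by rewrite qfactinv_lt0 ?mulr0 ?mul0r // subr_lt0 ltz_nat.
Qed.

Definition bailey_kernel (n : nat) (k : int) : F :=
  qfactinv (n%:Z - k) * qfactinv (n%:Z + k).

Lemma bailey_kernelN n k : bailey_kernel n (- k) = bailey_kernel n k.
Proof. by rewrite /bailey_kernel opprK mulrC. Qed.

Lemma bailey_kernel_small n (k : nat) : (n < k)%N -> bailey_kernel n k%:Z = 0.
Proof. by move=> lt_nk; rewrite /bailey_kernel qfactinv_lt0 ?mul0r //; lia. Qed.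

Variable s : F.
Hypothesis s_sqrt : s ^+ 2 = q.

Lemma sqrnE_bin2 n : (n ^ 2 = n + 2 * 'C(n, 2))%N.
Proof. by elim: n => [|n IHn] //; rewrite binS bin1; lia. Qed.

(** Only k <= j <= n contributes. With j = r + k and n = N + k this is q-Chu-Vandermonde for b = e =
    -s q^k: then b e q^r = q^(2k+r+1), so (b e q^r)_(N-r) is the quotient of (q)_(2k+N) by
    (q)_(2k+r). *)
Lemma bailey_step_nat n (k B : nat) : (n < B)%N ->
  \sum_(j < B) s ^+ (j ^ 2)%N * qbinom q n j
     * (qpoch q (- s) j * qpoch q q j * bailey_kernel j k%:Z)
  = s ^+ (k ^ 2)%N * (qpoch q (- s) n * qpoch q q n * bailey_kernel n k%:Z).
Proof.
move=> lt_nB; have [lt_nk|le_kn] := ltnP n k.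
  rewrite bailey_kernel_small // !mulr0 big1 // => j _.
  have [lt_nj|le_jn] := ltnP n j; first by rewrite qbinom_small // mulr0 mul0r.
  by rewrite bailey_kernel_small ?mulr0 //; apply: leq_ltn_trans lt_nk.
have [N defn] : exists N, n = (N + k)%N by exists (n - k)%N; rewrite subnK.
rewrite -(big_mkord xpredT (fun j => s ^+ (j ^ 2)%N * qbinom q n j
     * (qpoch q (- s) j * qpoch q q j * bailey_kernel j k%:Z))).
rewrite (big_cat_nat (n := n.+1)) //= [X in _ + X]big_nat_cond.
rewrite [X in _ + X]big1 ?addr0; last first.
  by move=> j /andP[/andP[lt_nj _] _]; rewrite qbinom_small // mulr0 mul0r.
rewrite (big_cat_nat (n := k)) ?leqW //= [X in X + _]big_nat_cond.
rewrite [X in X + _]big1 ?add0r; last first.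
  by move=> j /andP[/andP[_ lt_jk] _]; rewrite bailey_kernel_small ?mulr0.
rewrite -{1}[k]add0n big_addn defn subSn ?leq_addl // addnK big_mkord.
have -> : qpoch q (- s) (N + k)
        = qpoch q (- s) k * qpoch q (- s * q ^+ k) N by rewrite addnC qpochD.
rewrite -(q_chu_vandermonde N (- s * q ^+ k) (- s * q ^+ k)).
rewrite mulr_sumr !mulr_suml !mulr_sumr; apply: eq_bigr => -[r /=].
rewrite ltnS => le_rN _.
have [d defN] : exists d, N = (r + d)%N by exists (N - r)%N; rewrite subnKC.
rewrite defN addKn {N defn defN lt_nB le_kn le_rN}.
have -> : s ^+ ((r + k) ^ 2)%N
        = s ^+ (k ^ 2)%N * (- (- s * q ^+ k)) ^+ r * q ^+ 'C(r, 2).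
  rewrite mulNr opprK exprMn -s_sqrt -!exprM -!exprD; congr (_ ^+ _).
  by rewrite sqrnD (sqrnE_bin2 r); lia.
have -> : - s * q ^+ k * (- s * q ^+ k) * q ^+ r = q * q ^+ (r + k + k).
  transitivity (s ^+ 2 * (q ^+ k * q ^+ k * q ^+ r)); first by ring.
  by rewrite s_sqrt !exprD; ring.
rewrite !qbinomE /bailey_kernel.
have -> : (r + d + k)%N%:Z - (r + k)%N%:Z = d%:Z by lia.
have -> : (r + d)%N%:Z - r%:Z = d%:Z by lia.
have -> : (r + k)%N%:Z - k%:Z = r%:Z by lia.
have -> : (r + d + k)%N%:Z - k%:Z = (r + d)%N%:Z by lia.
have -> : (r + k)%N%:Z + k%:Z = (r + k + k)%N%:Z by lia.
have -> : (r + d + k)%N%:Z + k%:Z = (r + k + k + d)%N%:Z by lia.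
have qd := qfact_neq0 (r + k + k + d); move: (qd); rewrite qpochD mulf_eq0.
have -> : qpoch q (- s) (r + k)
        = qpoch q (- s) k * qpoch q (- s * q ^+ k) r by rewrite addnC qpochD.
rewrite negb_or => /andP[_ qd'] /=; rewrite [qpoch q q (r + k + k + d)]qpochD.
by field; rewrite !qfact_neq0 qd'.
Qed.

Lemma bailey_step n (k : int) (B : nat) : (n < B)%N ->
  \sum_(j < B) s ^+ (j ^ 2)%N * qbinom q n j
     * (qpoch q (- s) j * qpoch q q j * bailey_kernel j k)
  = s ^ (k ^+ 2) * (qpoch q (- s) n * qpoch q q n * bailey_kernel n k).
Proof.
have kernel_abs j : bailey_kernel j k = bailey_kernel j `|k|%N%:Z.
  by rewrite abszE; case: ger0P => // _; rewrite bailey_kernelN.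
have -> : k ^+ 2 = (`|k| ^ 2)%N%:Z by lia.
rewrite -exprnP kernel_abs => /(bailey_step_nat `|k|) <-; apply: eq_bigr => j _.
by rewrite kernel_abs.
Qed.

Lemma bailey_kernel_pred n k : bailey_kernel n k
  = (1 - q ^ (n.+1%:Z - k)) * (1 - q ^ (n.+1%:Z + k)) * bailey_kernel n.+1 k.
Proof.
rewrite /bailey_kernel.
have -> : n%:Z - k = n.+1%:Z - k - 1 by lia.
have -> : n%:Z + k = n.+1%:Z + k - 1 by lia.
by rewrite !qfactinv_pred; ring.
Qed.

(* By Pascal's rule the shift of q^{j^2/2} to q^{(j-1)^2/2} turns the sum into
   the difference of two consecutive values of [bailey_step]. *)
Lemma bailey_shifted_step n (k : int) (B : nat) : (n < B)%N ->
  s ^ (k ^+ 2) * (qpoch q (- s) n.+1 * qpoch q q n.+1 * bailey_kernel n.+1 k)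
  - \sum_(j < B) s ^+ (j ^ 2)%N * qbinom q n j
     * (qpoch q (- s) j.+1 * qpoch q q j.+1 * bailey_kernel j.+1 k)
  = s * s ^ (k ^+ 2) * (qpoch q (- s) n * qpoch q q n * bailey_kernel n.+1 k)
    * (1 - q ^ k - q ^ (- k) + q ^+ n + q ^+ n.+1 - q ^+ (n + n.+1)).
Proof.
move=> lt_nB; pose X j := qpoch q (- s) j * qpoch q q j * bailey_kernel j k.
have E : q ^+ n.+1 * (\sum_(j < B) s ^+ (j ^ 2)%N * qbinom q n j * X j.+1)
       = s * (s ^ (k ^+ 2) * X n.+1 - s ^ (k ^+ 2) * X n).
  rewrite -(bailey_step (B := B.+1) k) // -(bailey_step (B := B.+1) k) ?leqW //.
  rewrite -sumrB big_ord_recl !qbinom0 subrr add0r !mulr_sumr.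
  apply: eq_bigr => -[j /= _] _; rewrite /bump leq0n add1n -/(X j.+1).
  have [lt_nj|le_jn] := ltnP n j.
    rewrite (qbinom_small lt_nj) (qbinom_small (leqW lt_nj)).
    by rewrite (@qbinom_small n.+1 j.+1) // !(mulr0, mul0r) subrr mulr0.
  have -> : s ^+ (j.+1 ^ 2)%N = s ^+ (j ^ 2)%N * q ^+ j * s.
    by rewrite -s_sqrt -exprM -exprD -exprSr; congr (_ ^+ _); lia.
  have -> : q ^+ n.+1 = q ^+ j * s ^+ 2 * q ^+ (n - j).
    by rewrite s_sqrt -exprSr -exprD addSn subnKC.
  by rewrite qbinomS //; ring.
have qn0 : q ^+ n.+1 != 0 by rewrite expf_neq0.
(* After multiplication by q^(n+1), E removes the sum; expressing U(n, k) through U(n+1, k) leaves a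
   rational identity in q^k and q^n. *)
apply: (mulfI qn0); rewrite mulrBr [X in _ - X]E {E} /X.
rewrite (bailey_kernel_pred n k) !qpochSr !expfzDr // -invr_expz.
have qk0 : q ^ k != 0 by rewrite expfz_neq0.
rewrite -exprnP exprD; move: (q ^ k) (s ^ _) (bailey_kernel _ _) qk0 => K S U K0.
by rewrite !exprS -s_sqrt; field.
Qed.

(** As functions of n, the products (-s)_n (q)_n U(n, k) are eigenvectors of the unshifted
    summation, with eigenvalue s^(k^2). *)
Definition weighted_kernel_sum (K : seq int) (c : int -> F) (n : nat) : F :=
  \sum_(k <- K) c k * (qpoch q (- s) n * qpoch q q n * bailey_kernel n k).

(** Here j stands for n_i, n for n_(i+1) and d for the Kronecker delta. Any bound B > n + d captures
    all the nonzero terms. *)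
Definition nested_step (B d : nat) (f : nat -> F) (n : nat) : F :=
  \sum_(j < B) s ^+ (j ^ 2)%N * qbinom q (n + d) j * f j.

Lemma nested_step_kernel B d K c n : (n + d < B)%N ->
  nested_step B d (weighted_kernel_sum K c) n
  = weighted_kernel_sum K (fun k => s ^ (k ^+ 2) * c k) (n + d).
Proof.
move=> lt_nB; rewrite /nested_step /weighted_kernel_sum.
under eq_bigr => j _ do rewrite mulr_sumr.
rewrite exchange_big; apply: eq_bigr => k _ /=.
rewrite [_ * c k]mulrC -[RHS]mulrA -(bailey_step k lt_nB) mulr_sumr.
by apply: eq_bigr => j _; ring.
Qed.

(** A finite stand-in for Z, the interval [-L, L]; [Negz i] is -(i + 1), hence the shorter second
    range. *)
Definition int_window (L : nat) : seq int :=
  map Posz (iota 0 L.+1) ++ map Negz (iota 0 L).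

Lemma big_int_window L (f : int -> F) :
  \sum_(k <- int_window L) f k
  = f 0 + \sum_(k < L) (f k.+1%:Z + f (- k.+1%:Z)).
Proof.
rewrite big_cat !big_map /= big_cons -addrA big_split; congr (_ + (_ + _)).
  rewrite -(addn0 1%N) iotaDl big_map -(big_mkord xpredT (fun k => f k.+1%:Z)).
  by rewrite /index_iota subn0.
by rewrite -(big_mkord xpredT (fun k => f (- k.+1%:Z))) /index_iota subn0.
Qed.

Lemma big_int_window_odd L (f : int -> F) :
  (forall k, f (- k) = - f k) -> f 0 = 0 -> \sum_(k <- int_window L) f k = 0.
Proof.
move=> fN f0; rewrite big_int_window f0 add0r big1 // => k _.
by rewrite fN subrr.
Qed.

(** * Bailey pairs with symmetric g *)

Section SymmetricPair.
Variables (alpha beta : nat -> F) (g : int -> F).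
Hypothesis bailey : bailey_pair q 1 alpha beta.
Hypothesis g0 : g 0 = 1.
Hypothesis alphaE : forall n : nat,
  alpha n = if n == 0%N then 1 else (1 + q ^+ n) * g n%:Z.
Hypothesis gN : forall n : int, g (- n) = q ^ n * g n.

(** By the symmetry of g, (1 + q^k) g_k = g_k + g_(-k), so each alpha_k with k >= 1 splits into the
    terms at k and -k of an even kernel. Terms with |k| > n vanish, which leaves L free. *)
Lemma symmetric_pair_beta L n : (n <= L)%N ->
  beta n = \sum_(k <- int_window L) g k * bailey_kernel n k.
Proof.
move=> le_nL; rewrite bailey mul1r big_int_window g0 mul1r.
have termE k : (k <= n)%N -> alpha k / (qpoch q q (n - k) * qpoch q q (n + k))
     = alpha k * bailey_kernel n k%:Z.
  by move=> le_kn; rewrite /bailey_kernel subzn // -PoszD /= invfM.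
rewrite big_ord_recl termE //= alphaE mul1r; congr (_ + _).
rewrite -[in RHS](big_mkord xpredT (fun k => g k.+1%:Z * bailey_kernel n k.+1%:Z
  + g (- k.+1%:Z) * bailey_kernel n (- k.+1%:Z))) (big_cat_nat (n := n)) //=.
rewrite [X in _ = _ + X]big_nat_cond [X in _ = _ + X]big1 ?addr0; last first.
  move=> k /andP[/andP[le_nk _] _].
  by rewrite bailey_kernelN bailey_kernel_small // !mulr0 addr0.
rewrite big_mkord; apply: eq_bigr => k _; rewrite /bump leq0n add1n termE //.
by rewrite bailey_kernelN gN alphaE /= -exprnP; ring.
Qed.

(** The index r counts the summations already carried out, each contributing a factor s^(k^2). *)
Definition pair_kernel_sum (L r : nat) : nat -> F :=
  weighted_kernel_sum (int_window L) (fun k => s ^ (r%:Z * k ^+ 2) * g k).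

Lemma pair_kernel_sum0 L n : (n <= L)%N ->
  qpoch q (- s) n * qpoch q q n * beta n = pair_kernel_sum L 0 n.
Proof.
move=> le_nL; rewrite (symmetric_pair_beta le_nL) mulr_sumr.
by apply: eq_bigr => k _; rewrite mul0r expr0z; ring.
Qed.

Hypothesis s_neq0 : s != 0.

Lemma nested_step_pair B L d r n : (n + d < B)%N ->
  nested_step B d (pair_kernel_sum L r) n = pair_kernel_sum L r.+1 (n + d).
Proof.
move=> lt_nB; rewrite nested_step_kernel //; apply: eq_bigr => k _.
by rewrite -[r.+1]add1n PoszD mulrDl mul1r expfzDr // !mulrA.
Qed.

(** Adding this coefficient of U(n+1, k) to the last factor in [bailey_shifted_step] leaves (1 -
    q^k) (1 - q^(2n+1)); the factor 1 - q^k is the source of the odd part. *)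
Lemma kernel_shift n k :
  q ^ (- k) * bailey_kernel n (k - 1)
  = (q ^ (- k) - q ^+ n - q ^+ n.+1 + q ^ k * q ^+ (n + n.+1)) * bailey_kernel n.+1 k.
Proof.
rewrite /bailey_kernel.
have -> : n%:Z - (k - 1) = n.+1%:Z - k by lia.
have -> : n%:Z + (k - 1) = n.+1%:Z + k - 1 - 1 by lia.
rewrite !qfactinv_pred -addrA !expfzDr // exprD.
have qk0 : q ^ k != 0 by rewrite expfz_neq0.
by rewrite -!invr_expz -!exprnP exprS; field; rewrite q_neq0 qk0.
Qed.

(* The two kernels differ by a function that is odd in k thanks to the symmetry
   of g. *)
Lemma pair_shifted_step B L r n : (n < B)%N ->
  pair_kernel_sum L r.+1 n.+1
  - nested_step B 0 (fun j => pair_kernel_sum L r j.+1) n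
  = - s * weighted_kernel_sum [seq k - 1 | k <- int_window L]
      (fun k => s ^ (r.+1%:Z * (k + 1) ^+ 2) * q ^ (- (k + 1)) * g (k + 1)) n.
Proof.
move=> lt_nB; pose G k := s ^ (r.+1%:Z * k ^+ 2) * g k.
pose P := qpoch q (- s) n * qpoch q q n.
transitivity (\sum_(k <- int_window L) s * G k * P * bailey_kernel n.+1 k
    * (1 - q ^ k - q ^ (- k) + q ^+ n + q ^+ n.+1 - q ^+ (n + n.+1))).
  rewrite /nested_step /pair_kernel_sum /weighted_kernel_sum addn0.
  under [X in _ - X]eq_bigr => j _ do rewrite mulr_sumr.
  rewrite exchange_big -sumrB; apply: eq_bigr => k _ /=.
  transitivity (s ^ (r%:Z * k ^+ 2) * g k * (s * s ^ (k ^+ 2) * (P * bailey_kernel n.+1 k)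
    * (1 - q ^ k - q ^ (- k) + q ^+ n + q ^+ n.+1 - q ^+ (n + n.+1)))).
    rewrite -(bailey_shifted_step k lt_nB) mulrBr; congr (_ - _).
      by rewrite -[in LHS]add1n PoszD mulrDl mul1r expfzDr //; ring.
    by rewrite mulr_sumr; apply: eq_bigr => j _; ring.
  by rewrite /G -[in RHS]add1n PoszD mulrDl mul1r expfzDr //; ring.
apply/eqP; rewrite -subr_eq0 mulr_sumr big_map -sumrB; apply/eqP.
transitivity (\sum_(k <- int_window L) s * P * (1 - q ^+ (n + n.+1)) *
   (G k * (1 - q ^ k) * bailey_kernel n.+1 k)).
  apply: eq_bigr => k _; rewrite subrK -/(G k).
  rewrite -/P mulNr opprK.
  transitivity (s * G k * P * (bailey_kernel n.+1 k
    * (1 - q ^ k - q ^ (- k) + q ^+ n + q ^+ n.+1 - q ^+ (n + n.+1))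
    + q ^ (- k) * bailey_kernel n (k - 1))); first by rewrite /G; ring.
  by rewrite kernel_shift; ring.
(* Since G(-k) = q^k G(k), the product G(k) (1 - q^k) is odd in k, while the kernel is even. *)
apply: big_int_window_odd => [k|]; last first.
  by rewrite expr0z subrr mulr0 mul0r mulr0.
rewrite -mulrN; congr (_ * _); rewrite bailey_kernelN -mulNr; congr (_ * _).
rewrite /G sqrrN gN -invr_expz.
have qk0 : q ^ k != 0 by rewrite expfz_neq0.
by field.
Qed.
End SymmetricPair.

(** * Multiple sums with a finite last index M *)

(* The weight of (n_1, ..., n_m) with n_{m+1} = M as an additional argument of
   the last binomial, the d-th binomial being the one with a shift. *)
Fixpoint chain_weight (M d : nat) (t : seq nat) : F :=
  if t is x :: t' then
    s ^+ (x ^ 2)%N * qbinom q (head M t' + (d == 1%N)) x * chain_weight M d.-1 t'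
  else 1.

(* A finite box containing all the tuples with n_{m+1} = M and nonzero weight. *)
Fixpoint chains (M m : nat) : seq (m.-tuple nat) :=
  if m is m'.+1 then
    [seq cons_tuple x t | x <- iota 0 (M + m' + 2), t <- chains M m']
  else [:: [tuple]].

(** The default of [head] gives the value f M when m = 0, where n_1 is n_(m+1) = M. *)
Definition chain_sum (M m d : nat) (f : nat -> F) : F :=
  \sum_(t <- chains M m) chain_weight M d t * f (head M t).

Lemma mem_chainsS M m x (t : m.-tuple nat) :
  (cons_tuple x t \in chains M m.+1) = (x < M + m + 2)%N && (t \in chains M m).
Proof.
apply/allpairsP/andP => [[[y u] [/= yB ut E]]|[xB tM]]; last first.
  by exists (x, t); split=> //=; rewrite mem_iota.
have [-> ttu] : x = y /\ tval t = tval u by case: (congr1 val E).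
by rewrite (val_inj ttu); rewrite mem_iota in yB.
Qed.

Lemma chains_uniq M m : uniq (chains M m).
Proof.
elim: m => // m IHm; apply: allpairs_uniq => //; first exact: iota_uniq.
move=> [x t] [y u] _ _ /= E; have [-> ttu] : x = y /\ tval t = tval u.
  by case: (congr1 val E).
by rewrite (val_inj ttu).
Qed.

(** The bound grows by one with each index, which leaves room for a shift: n + d < M + m + 2 as soon
    as n <= M + m and d <= 1. *)
Lemma chains_head M m (t : m.-tuple nat) :
  t \in chains M m -> (head M t <= M + m)%N.
Proof.
case: m t => [|m] t; first by rewrite tuple0 addn0.
by case/tupleP: t => x t; rewrite mem_chainsS => /andP[lt_x _] /=; lia.
Qed.

Lemma eq_chain_sum M m d f f' :
  (forall n, (n <= M + m)%N -> f n = f' n) -> chain_sum M m d f = chain_sum M m d f'.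
Proof.
by move=> ff'; apply: eq_big_seq => t /chains_head le_t; rewrite ff'.
Qed.

(** The innermost index n_1 is summed first; the remaining indices are renumbered, so the position
    of the shift drops by one. *)
Lemma chain_sumS M m d f :
  chain_sum M m.+1 d f
  = chain_sum M m d.-1 (nested_step (M + m + 2) (d == 1%N) f).
Proof.
rewrite /chain_sum /= big_allpairs_dep exchange_big; apply: eq_bigr => t _ /=.
rewrite mulr_sumr -(big_mkord xpredT (fun j => chain_weight M d.-1 t *
  (s ^+ (j ^ 2)%N * qbinom q (head M t + (d == 1%N)) j * f j))) /index_iota subn0.
by apply: eq_bigr => x _; ring.
Qed.

Lemma chain_sumB M m d f f' :
  chain_sum M m d f - chain_sum M m d f' = chain_sum M m d (fun n => f n - f' n).
Proof. by rewrite -sumrB; apply: eq_bigr => t _; rewrite mulrBr. Qed.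

Lemma chain_sumZ M m d c f :
  chain_sum M m d (fun n => c * f n) = c * chain_sum M m d f.
Proof. by rewrite mulr_sumr; apply: eq_bigr => t _; rewrite mulrCA. Qed.

Hypothesis s_neq0 : s != 0.

Lemma chain_sum_kernel M m K c :
  chain_sum M m 0 (weighted_kernel_sum K c)
  = weighted_kernel_sum K (fun k => s ^ (m%:Z * k ^+ 2) * c k) M.
Proof.
elim: m c => [|m IHm] c.
  rewrite /chain_sum big_seq1 mul1r /=; apply: eq_bigr => k _.
  by rewrite mul0r expr0z mul1r.
rewrite chain_sumS; under eq_chain_sum => n le_n.
  rewrite nested_step_kernel ?addn0; last by lia.
  over.
rewrite IHm; apply: eq_bigr => k _.
by rewrite -[m.+1]addn1 PoszD mulrDl mul1r expfzDr // !mulrA.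
Qed.

Section ChainsOfPairs.
Variables (alpha beta : nat -> F) (g : int -> F).
Hypothesis bailey : bailey_pair q 1 alpha beta.
Hypothesis g0 : g 0 = 1.
Hypothesis alphaE : forall n : nat,
  alpha n = if n == 0%N then 1 else (1 + q ^+ n) * g n%:Z.
Hypothesis gN : forall n : int, g (- n) = q ^ n * g n.

(** The first d + 1 summations are diagonal, and the last of them, being shifted, is evaluated at n
    + 1; e unshifted ones remain. *)
Lemma chain_sum_pair M e d L r :
  chain_sum M (e + d.+1) d.+1 (pair_kernel_sum g L r)
  = chain_sum M e 0 (fun n => pair_kernel_sum g L (r + d.+1) n.+1).
Proof.
elim: d r => [|d IHd] r; rewrite addnS chain_sumS.
  rewrite addn0; apply: eq_chain_sum => n le_n.
  by rewrite nested_step_pair ?addn1 //; lia.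
rewrite -[(r + _)%N]addSnnS -IHd; apply: eq_chain_sum => n le_n.
by rewrite nested_step_pair ?addn0 //; lia.
Qed.

(** The shift now comes one summation earlier, or inside beta when d = 0, so the next summation acts
    on a function of n + 1 and is left unevaluated. *)
Lemma chain_sum_pair_pred M e d L :
  chain_sum M (e + d.+1) d (fun n => pair_kernel_sum g L 0 (n + (d == 0))%N)
  = chain_sum M e 0
      (nested_step (M + e + 2) 0 (fun n => pair_kernel_sum g L d n.+1)).
Proof.
case: d => [|d].
  rewrite addn1 chain_sumS /=; apply: eq_chain_sum => n _.
  by apply: eq_bigr => j _; rewrite addn1.
under eq_chain_sum => n _ do rewrite addn0.
by rewrite addnS -addSn chain_sum_pair chain_sumS.
Qed.

(** Here a = d + 1 and m = e + d + 1. Both series reduce to e-fold unshifted chains,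
    [pair_shifted_step] gives the difference of their arguments, and the other e summations are
    diagonal. *)
Lemma finite_identity M e d :
  chain_sum M (e + d.+1) d.+1 (fun n => qpoch q (- s) n * qpoch q q n * beta n)
  - chain_sum M (e + d.+1) d (fun n => qpoch q (- s) (n + (d == 0))%N *
      qpoch q q (n + (d == 0))%N * beta (n + (d == 0))%N)
  = - s ^+ d * \sum_(n <- [seq k - 1 | k <- int_window (M + (e + d.+1)).+1])
      qpoch q (- s) M * qpoch q q M * bailey_kernel M n * summand3 s g (e + d.+1) d.+1 n.
Proof.
(* The index n_1 is at most M + m, and beta is taken at n_1 + 1 when d = 0. *)
set L := (M + (e + d.+1)).+1.
rewrite (@eq_chain_sum _ _ _ _ (pair_kernel_sum g L 0)); last first.
  by move=> n le_n; apply: pair_kernel_sum0 => //; rewrite leqW.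
rewrite chain_sum_pair.
rewrite (@eq_chain_sum _ _ d _ (fun n => pair_kernel_sum g L 0 (n + (d == 0))%N)); last first.
  move=> n le_n; apply: pair_kernel_sum0 => //.
  by have := leq_b1 (d == 0%N); rewrite /L; lia.
rewrite chain_sum_pair_pred chain_sumB add0n.
under eq_chain_sum => n le_n.
  rewrite pair_shifted_step //; last by lia.
  over.
rewrite chain_sumZ chain_sum_kernel !mulr_sumr; apply: eq_bigr => k _.
have E : s * s ^ (e%:Z * k ^+ 2) * s ^ (d.+1%:Z * (k + 1) ^+ 2) * q ^ (- (k + 1))
       = s ^+ d * s ^ ((e + d.+1)%N%:Z * k ^+ 2 + 2 * (k * d.+1%:Z - k)).
  rewrite -s_sqrt -{1}[s]expr1z !exprnP exprz_exp -!expfzDr //.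
  by congr (_ ^ _); rewrite PoszD -[d.+1]addn1 PoszD; ring.
transitivity (- (s * s ^ (e%:Z * k ^+ 2) * s ^ (d.+1%:Z * (k + 1) ^+ 2)
  * q ^ (- (k + 1))) * g (k + 1)
  * (qpoch q (- s) M * qpoch q q M * bailey_kernel M k)); first by ring.
by rewrite E /summand3; ring.
Qed.
End ChainsOfPairs.

Lemma chain_weightE M d t :
  chain_weight M d t
  = s ^+ (\sum_(i < size t) nth 0%N t i ^ 2)%N
    * \prod_(i < size t) qbinom q (nth M t i.+1 + (d == i.+1)) (nth 0%N t i).
Proof.
elim: t d => [|x t IHt] d /=; first by rewrite !big_ord0 mulr1.
rewrite !big_ord_recl IHt exprD /= nth0.
have -> : \prod_(i < size t) qbinom q (nth M t i.+1 + (d.-1 == i.+1)) (nth 0%N t i)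
  = \prod_(i < size t) qbinom q (nth M t (bump 0 i) + (d == (bump 0 i).+1)) (nth 0%N t i).
  by apply: eq_bigr => i _; rewrite /bump leq0n add1n; case: d.
by ring.
Qed.

(** All dependence on M is isolated in the last factor, which tends to 1 as M grows. *)
Lemma chain_weight_nidx M d m (t : m.+1.-tuple nat) :
  chain_weight M d t
  = s ^+ (\sum_(1 <= i < m.+2) nidx t i ^ 2)%N
    / qpoch q q (nidx t m.+1)
    * \prod_(1 <= i < m.+1) qbinom q (nidx t i.+1 + (d == i))%N (nidx t i)
    * (qpoch q q (nidx t m.+1) * qbinom q (M + (d == m.+1)) (nidx t m.+1)).
Proof.
rewrite chain_weightE size_tuple [X in _ * X]big_ord_recr /=.
rewrite !big_add1 /= !big_mkord [nth M t m.+1]nth_default ?size_tuple //.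
have -> : \prod_(i < m) qbinom q (nth M t i.+1 + (d == i.+1)) (nth 0%N t i)
  = \prod_(i < m) qbinom q (nidx t i.+2 + (d == i.+1)) (nidx t i.+1).
  apply: eq_bigr => i _; rewrite /nidx /=; congr (qbinom _ (_ + _) _).
  by apply: set_nth_default; rewrite size_tuple ltnS.
rewrite /nidx /=; have := qfact_neq0 (nth 0%N t m); set w := qpoch q q _ => w0.
by field.
Qed.
End FiniteIdentities.

(** * Unordered sums *)

Section UnorderedSums.
Variables (R : realType) (I : choiceType).
Local Notation normc := ComplexField.Normc.normc.

Lemma big_uniq_subset (V : nmodType) (J A : seq I) (F : I -> V) :
  uniq J -> uniq A -> {subset J <= A} ->
  \sum_(i <- A) F i = \sum_(i <- J) F i + \sum_(i <- A | i \notin J) F i.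
Proof.
move=> uJ uA sJA; rewrite (bigID (mem J)) /=; congr (_ + _).
rewrite -big_filter; apply/perm_big/uniq_perm; rewrite ?filter_uniq //.
by move=> i; rewrite mem_filter; apply: andb_idr; exact: sJA.
Qed.

(** Sums of nonnegative terms grow with the index set, so they approach their supremum from
    below. *)
Lemma sup_of_sums (p : I -> R) (S : R) : (forall i, 0 <= p i) ->
    (forall A, uniq A -> \sum_(i <- A) p i <= S) ->
  exists l, forall e, 0 < e -> exists2 J : seq I, uniq J &
    forall A, uniq A -> {subset J <= A} -> l - e < \sum_(i <- A) p i <= l.
Proof.
move=> p0 pS; pose E := [set x | exists2 A, uniq A & x = \sum_(i <- A) p i]%classic.
have supE : has_sup E.
  split; first by exists 0, [::]; rewrite ?big_nil.
  by exists S => _ [A uA ->]; exact: pS.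
exists (sup E) => e e0; have [_ [J uJ ->] ltJ] := sup_adherent e0 supE.
exists J => // A uA sJA; apply/andP; split.
  by rewrite (lt_le_trans ltJ) // (big_uniq_subset _ uJ uA sJA) lerDl sumr_ge0.
by apply: sup_upper_bound => //; exists A.
Qed.

Lemma normc_ReIm (z : R[i]) : normc z <= `|complex.Re z| + `|complex.Im z|.
Proof.
case: z => a b /=; rewrite -[leRHS]ger0_norm ?addr_ge0 // -sqrtr_sqr.
rewrite ler_wsqrtr // sqrrD -(real_normK (num_real a)) -(real_normK (num_real b)).
by rewrite -addrA lerD2l lerDr mulrn_wge0 // mulr_ge0.
Qed.

Lemma normc_ge0 (z : R[i]) : 0 <= normc z.
Proof. by case: z => a b; rewrite sqrtr_ge0. Qed.

Lemma ler_Re_normc (z : R[i]) : `|complex.Re z| <= normc z.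
Proof. by case: z => a b /=; rewrite -sqrtr_sqr ler_wsqrtr // lerDl sqr_ge0. Qed.

Lemma ler_Im_normc (z : R[i]) : `|complex.Im z| <= normc z.
Proof. by case: z => a b /=; rewrite -sqrtr_sqr ler_wsqrtr // lerDr sqr_ge0. Qed.

Definition bounded_sums (f : I -> R[i]) : Prop :=
  exists S : R, forall A, uniq A -> \sum_(i <- A) normc (f i) <= S.

Lemma abs_summable_bounded_sums (f : I -> R[i]) : abs_summable f -> bounded_sums f.
Proof.
rewrite /abs_summable summableE => fin.
exists (fine (esum setT (fun i => `|(normc (f i))%:E|%E))) => A uA.
rewrite -lee_fin fineK // -sumEFin fsbig_seq //; apply: ereal_sup_ubound.
exists [set` A]%classic; first by split.
by apply: eq_fsbigr => i _; rewrite /= ger0_norm ?normc_ge0.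
Qed.

Lemma bounded_sums_tail (f : I -> R[i]) : bounded_sums f ->
  forall e : R, 0 < e -> exists2 J : seq I, uniq J &
    forall A, uniq A -> {subset J <= A} -> \sum_(i <- A | i \notin J) normc (f i) < e.
Proof.
move=> [S fS] e e0.
have nf0 i : 0 <= normc (f i) by exact: normc_ge0.
have [l lP] := sup_of_sums nf0 fS; have [J uJ JP] := lP e e0.
exists J => // A uA sJA.
have /andP[ltJ _] := JP J uJ (fun _ => id).
have /andP[_] := JP A uA sJA; rewrite (big_uniq_subset _ uJ uA sJA).
by lra.
Qed.

(** Real and imaginary parts are treated separately, each as a difference of two nonnegative
    families with bounded sums: h = (h + |f|) - |f|. *)
Lemma csum_cvg (f : I -> R[i]) : bounded_sums f ->
  forall e : R, 0 < e -> exists2 J : seq I, uniq J &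
    forall A, uniq A -> {subset J <= A} -> normc (csum f - \sum_(i <- A) f i) < e.
Proof.
move=> bf; suff [l lP] : exists l, forall e : R, 0 < e -> exists2 J : seq I, uniq J &
    forall A, uniq A -> {subset J <= A} -> normc (l - \sum_(i <- A) f i) < e.
  (* Limits being unique, it is enough to exhibit one. *)
  suff -> : csum f = l by [].
  have totallyF := @summability.totally_filter I.
  apply: (@cvg_lim R[i]^o); first exact: norm_hausdorff.
  apply/cvgrPdist_lt => e; rewrite ltcE /= => /andP[/eqP Ime Ree].
  have [J uJ JP] := lP _ Ree.
  exists [fset i in J]%fset => // B /fsubsetP sJB; rewrite /= /summability.partial_sum.
  rewrite -(big_seq_fsetE _ _ xpredT) /=.
  have -> : e = (complex.Re e)%:C%C by case: e Ime {Ree JP} => a b /= ->.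
  by rewrite ltcR; apply: JP => // i iJ; apply: sJB; rewrite !inE.
have [S fS] := bf.
have nf0 i : 0 <= normc (f i) by exact: normc_ge0.
pose re i := complex.Re (f i); pose im i := complex.Im (f i).
have shift_sup (h : I -> R) : (forall i, `|h i| <= normc (f i)) ->
  exists l, forall e, 0 < e -> exists2 J : seq I, uniq J &
    forall A, uniq A -> {subset J <= A} -> `|l - \sum_(i <- A) h i| < e.
  move=> hf.
  have hp i : 0 <= h i + normc (f i) by have := hf i; rewrite ler_norml; lra.
  have hS A : uniq A -> \sum_(i <- A) (h i + normc (f i)) <= S + S.
    move=> uA; rewrite big_split lerD ?fS //=; apply: le_trans (fS A uA).
    by apply: ler_sum => i _; rewrite (le_trans (ler_norm _)).
  have [l1 l1P] := sup_of_sums hp hS; have [l2 l2P] := sup_of_sums nf0 fS.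
  exists (l1 - l2) => e e0.
  have [J1 uJ1 J1P] := l1P _ e0; have [J2 uJ2 J2P] := l2P _ e0.
  exists (undup (J1 ++ J2)); first exact: undup_uniq.
  move=> A uA sA.
  have /J1P : {subset J1 <= A} by move=> i iJ; apply: sA; rewrite mem_undup mem_cat iJ.
  have /J2P : {subset J2 <= A} by move=> i iJ; apply: sA; rewrite mem_undup mem_cat iJ orbT.
  move=> /(_ uA) + /(_ uA); rewrite big_split /= ltr_norml; lra.
have [l1 l1P] := shift_sup re (fun i => ler_Re_normc (f i)).
have [l2 l2P] := shift_sup im (fun i => ler_Im_normc (f i)).
exists (l1 +i* l2)%C => e e0; have e2 : 0 < e / 2 by rewrite divr_gt0.
have [J1 uJ1 J1P] := l1P _ e2; have [J2 uJ2 J2P] := l2P _ e2.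
exists (undup (J1 ++ J2)); first exact: undup_uniq.
move=> A uA sA.
have /J1P : {subset J1 <= A} by move=> i iJ; apply: sA; rewrite mem_undup mem_cat iJ.
have /J2P : {subset J2 <= A} by move=> i iJ; apply: sA; rewrite mem_undup mem_cat iJ orbT.
move=> /(_ uA) n2 /(_ uA) n1; apply: le_lt_trans (normc_ReIm _) _.
rewrite !raddfB /= !raddf_sum /= !sumrN [e]splitr; exact: ltrD.
Qed.
End UnorderedSums.

(** * Tannery's theorem for unordered sums *)

Section DominatedSums.
Variables (R : realType) (I : choiceType).
Local Notation normc := ComplexField.Normc.normc.

Lemma near_subset (A : nat -> seq I) (J : seq I) :
  (forall i, \forall n \near \oo%classic, i \in A n) ->
  \forall n \near \oo%classic, {subset J <= A n}.
Proof.
move=> memA; elim: J => [|j J IHJ]; first by near=> n.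
near=> n => i; rewrite inE => /orP[/eqP ->|].
  by near: n; exact: memA.
by move: i; near: n.
Unshelve. all: by end_near. Qed.

Lemma cvg_dominated_sums (f : I -> R[i]) (A : nat -> seq I)
    (c : nat -> I -> R[i]) (l K : R[i]) :
  0 <= K -> bounded_sums f -> (forall n, uniq (A n)) ->
  (forall i, \forall n \near \oo%classic, i \in A n) ->
  (forall n i, `|c n i| <= K) ->
  (forall i, (c n i : R[i]^o) @[n --> \oo] --> (l : R[i]^o))%classic ->
  ((\sum_(i <- A n) c n i * f i : R[i]^o) @[n --> \oo]
     --> (l * csum f : R[i]^o))%classic.
Proof.
move=> K0 bf uA memA cK cvgc.
apply/cvgrPdist_lt => e e0.
(* Three errors are to be absorbed: K e' from the terms outside J, |l| e' from replacing [csum f] by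
   its sum over J, and e' from the convergence on J. *)
pose e' := e / (K + `|l| + 2).
have den0 : 0 < K + `|l| + 2 by rewrite ltr_wpDl ?addr_ge0.
have e'0 : 0 < e' by rewrite divr_gt0.
have [r Er] : exists r : R, e' = r%:C%C.
  by apply/complex_realP; apply: gtr0_real.
have r0 : 0 < r by move: e'0; rewrite Er ltcR.
have [J1 uJ1 J1P] := bounded_sums_tail bf r0.
have [J2 uJ2 J2P] := csum_cvg bf r0.
pose J := undup (J1 ++ J2).
have uJ : uniq J by exact: undup_uniq.
have sJ1 : {subset J1 <= J} by move=> i iJ; rewrite mem_undup mem_cat iJ.
have sJ2 : {subset J2 <= J} by move=> i iJ; rewrite mem_undup mem_cat iJ orbT.
have cvgJ : ((\sum_(i <- J) c n i * f i : R[i]^o) @[n --> \oo]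
    --> (\sum_(i <- J) l * f i : R[i]^o))%classic.
  apply: (@cvg_big R[i]^o I +%R 0) => [|i _]; first exact: add_continuous.
  by apply: cvgMr_tmp; exact: cvgc.
move/cvgrPdist_lt : cvgJ => /(_ _ e'0) cvgJ.
near=> n.
have sJA : {subset J <= A n} by near: n; exact: near_subset.
have nJ : `|\sum_(i <- J) l * f i - \sum_(i <- J) c n i * f i| < e'.
  by near: n.
rewrite (big_uniq_subset _ uJ (uA n) sJA).
set X := \sum_(i <- J) c n i * f i in nJ *; set Y := \sum_(i <- A n | _) _.
have -> : l * csum f - (X + Y)
  = l * (csum f - \sum_(i <- J) f i) + (\sum_(i <- J) l * f i - X) - Y.
  by rewrite -mulr_sumr; ring.
have nY : `|Y| <= K * e'.
  apply: le_trans (ler_norm_sum _ _ _) _.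
  apply: (@le_trans _ _ (K * \sum_(i <- A n | i \notin J) `|f i|)).
    by rewrite mulr_sumr; apply: ler_sum => i _; rewrite normrM ler_wpM2r.
  rewrite ler_wpM2l // Er -[X in X <= _]/(\sum_(i <- A n | i \notin J) (normc (f i))%:C%C).
  rewrite -raddf_sum lecR ltW //.
  apply: le_lt_trans (J1P _ (uA n) (fun i iJ => sJA _ (sJ1 _ iJ))).
  rewrite big_mkcond [leRHS]big_mkcond /=; apply: ler_sum => i _.
  case: ifP => // iJ; last by case: ifP => // _; exact: normc_ge0.
  by rewrite (contra (sJ1 i)).
have nl : `|l * (csum f - \sum_(i <- J) f i)| <= `|l| * e'.
  rewrite normrM ler_wpM2l // Er -[X in X <= _]/((normc (csum f - \sum_(i <- J) f i))%:C%C).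
  by rewrite lecR ltW // J2P.
apply: (@lt_le_trans _ _ (`|l| * e' + e' + K * e')).
  apply: le_lt_trans (ler_normB _ _) _; apply: ltr_leD => //.
  by apply: le_lt_trans (ler_normD _ _) _; apply: ler_ltD.
have -> : e = (K + `|l| + 2) * e' by rewrite mulrC divfK // gt_eqF.
rewrite -subr_ge0 [leRHS](_ : _ = e'); [exact: ltW|ring].
Unshelve. all: by end_near. Qed.
End DominatedSums.

(** * Limits of q-shifted factorials *)

Section QPochhammerLimits.
Variables (R : realType) (q : R[i]).
Hypothesis q_lt1 : `|q| < 1.
Local Notation normc := ComplexField.Normc.normc.
Local Notation r := (normc q).

Lemma normr_normc (z : R[i]) : `|z| = (normc z)%:C%C.
Proof. by []. Qed.

Let r_ge0 : 0 <= r := normc_ge0 q.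

Let r_lt1 : r < 1.
Proof. by move: q_lt1; rewrite normr_normc -(rmorph1 (real_complex R)) ltcR. Qed.

Lemma geometric_sum_le n : \sum_(j < n) r ^+ j <= (1 - r)^-1.
Proof.
have r1 : 0 < 1 - r by rewrite subr_gt0.
rewrite -[_^-1]mul1r ler_pdivlMr // mulrC -opprB mulNr -subrX1 opprB.
by rewrite gerBl exprn_ge0.
Qed.

(** Each factor is at most exp(K r^j), and the exponents form a geometric series. *)
Lemma normc_prod_le (K : R) (u : nat -> R[i]) n : 0 <= K ->
  (forall j, normc (u j) <= 1 + K * r ^+ j) ->
  normc (\prod_(j < n) u j) <= expR (K / (1 - r)).
Proof.
move=> K0 uK; apply: (@le_trans _ _ (expR (K * \sum_(j < n) r ^+ j))); last first.
  by rewrite ler_expR ler_wpM2l // geometric_sum_le.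
elim: n => [|n IHn].
  by rewrite !big_ord0 mulr0 expR0 ComplexField.Normc.normc1.
rewrite !big_ord_recr /= mulrDr expRD ComplexField.Normc.normcM.
by rewrite ler_pM ?normc_ge0 // (le_trans (uK n)) // expR_ge1Dx.
Qed.

Lemma normr_prod_bounded (K : R) (u : nat -> R[i]) : 0 <= K ->
  (forall j, normc (u j) <= 1 + K * r ^+ j) ->
  exists2 B : R[i], 0 <= B & forall n, `|\prod_(j < n) u j| <= B.
Proof.
move=> K0 uK; exists (expR (K / (1 - r)))%:C%C; first by rewrite ler0c expR_ge0.
by move=> n; rewrite normr_normc lecR normc_prod_le.
Qed.

Lemma normcX (z : R[i]) n : normc (z ^+ n) = normc z ^+ n.
Proof.
by apply: complexI; rewrite -normr_normc normrX normr_normc rmorphXn.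
Qed.

Lemma qpoch_bounded x : exists2 B : R[i], 0 <= B & forall n, `|qpoch q x n| <= B.
Proof.
apply: (@normr_prod_bounded (normc x) (fun j => 1 - x * q ^+ j) (normc_ge0 x)) => j.
rewrite -normcX -ComplexField.Normc.normcM -lecR rmorphD rmorph1 /= -!normr_normc.
by rewrite -[1 in leRHS]normr1 ler_normB.
Qed.

Lemma one_sub_normc_gt0 j : 0 < 1 - r ^+ j.+1.
Proof. by rewrite subr_gt0 exprn_ilt1. Qed.

Lemma one_sub_normc_le j : 1 - r ^+ j.+1 <= normc (1 - q * q ^+ j).
Proof.
rewrite -exprS -normcX -lecR rmorphB rmorph1 /= -!normr_normc.
by rewrite -[1 in leLHS]normr1 lerB_dist.
Qed.

Lemma qpochqq_neq0 n : qpoch q q n != 0.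
Proof.
apply/prodf_neq0 => j _; apply: contraTneq (one_sub_normc_gt0 j) => q1.
have := one_sub_normc_le j; rewrite q1 ComplexField.Normc.normc0.
by rewrite leNgt => /negbTE ->.
Qed.

Lemma qfactinv_bounded :
  exists2 B : R[i], 0 <= B & forall z, `|qfactinv q z| <= B.
Proof.
have r1 : 0 < 1 - r by rewrite subr_gt0.
(* The constant comes from 1/(1 - t) = 1 + t/(1 - t) <= 1 + r^j/(1 - r) with t = r^(j+1). *)
have [||B B0 BP] := @normr_prod_bounded (1 - r)^-1 (fun j => (1 - q * q ^+ j)^-1).
- by rewrite invr_ge0 ltW.
- move=> j; rewrite ComplexField.Normc.normcV.
  have tj0 := one_sub_normc_gt0 j.
  apply: (@le_trans _ _ (1 - r ^+ j.+1)^-1).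
    by rewrite lef_pV2 ?posrE ?one_sub_normc_le // (lt_le_trans tj0) ?one_sub_normc_le.
  have -> : (1 - r ^+ j.+1)^-1 = 1 + (1 - r ^+ j.+1)^-1 * r ^+ j.+1.
    by apply: (mulfI (lt0r_neq0 tj0)); rewrite mulrDr mulrA divff ?lt0r_neq0 //; ring.
  rewrite lerD2l; apply: ler_pM; rewrite ?exprn_ge0 //.
  - by rewrite invr_ge0 ltW.
  - by rewrite lef_pV2 ?posrE // lerD2l lerN2 exprS ler_piMr // exprn_ile1 // ltW.
  - by rewrite exprS ler_piMl ?exprn_ge0 // ltW.
exists B => // -[n|n] /=; last by rewrite normr0.
by rewrite /qpoch -prodfV.
Qed.

(** The increments -x q^j (x)_j are a bounded sequence times a geometric one, hence absolutely
    summable, and they telescope to (x)_n - 1. *)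
Lemma qpoch_cvg x :
  ((qpoch q x n : R[i]^o) @[n --> \oo] --> (qpoch_inf q x : R[i]^o))%classic.
Proof.
suff [l cvgl] : exists l : R[i]^o,
    ((qpoch q x n : R[i]^o) @[n --> \oo] --> l)%classic.
  apply/cvg_ex; by exists l.
have [B B0 BP] := qpoch_bounded x.
pose D j := qpoch q x j.+1 - qpoch q x j.
have bD : bounded_sums D.
  exists (complex.Re B * normc x * (1 - r)^-1) => A uA.
  have sA : {subset A <= iota 0 (\max_(i <- A) i).+1}.
    by move=> i iA; rewrite mem_iota /= ltnS leq_bigmax_seq.
  apply: (@le_trans _ _ (complex.Re B * normc x * \sum_(j <- A) r ^+ j)).
    rewrite mulr_sumr; apply: ler_sum => j _.
    have -> : D j = qpoch q x j * (- x * q ^+ j) by rewrite /D qpochSr; ring.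
    rewrite ComplexField.Normc.normcM -mulrA.
    have -> : normc (- x * q ^+ j) = normc x * r ^+ j.
      by rewrite ComplexField.Normc.normcM normcX normcN.
    rewrite ler_wpM2r ?mulr_ge0 ?normc_ge0 ?exprn_ge0 //.
    by move: (BP j); rewrite normr_normc lecE => /andP[].
  rewrite ler_wpM2l ?mulr_ge0 ?normc_ge0 //.
    by move: B0; rewrite lecE => /andP[].
  apply: le_trans (geometric_sum_le (\max_(i <- A) i).+1).
  rewrite -(big_mkord xpredT (fun j => r ^+ j)) /index_iota subn0.
  rewrite (big_uniq_subset _ uA (iota_uniq _ _) sA) lerDl sumr_ge0 // => j _.
  exact: exprn_ge0.
exists (csum D + 1).
have := @cvg_dominated_sums _ _ D (iota 0) (fun _ _ => 1) 1 1.
rewrite mul1r => H.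
have {H} cvgS : ((\sum_(i <- iota 0 n) 1 * D i : R[i]^o) @[n --> \oo]
    --> (csum D : R[i]^o))%classic.
  apply: H => //.
  - by move=> n; exact: iota_uniq.
  - by move=> i; near=> n; rewrite mem_iota /=; near: n; exact: nbhs_infty_gt.
  - by move=> _ _; rewrite normr1.
  - by move=> i; exact: cvg_cst.
have -> : qpoch q x = (fun n => \sum_(i <- iota 0 n) 1 * D i + 1).
  apply/funext => n; rewrite -[n in iota _ n]subn0 -/(index_iota 0 n).
  under eq_bigr do rewrite mul1r.
  by rewrite telescope_sumr // qpoch0 subrK.
by apply: cvgD; [exact: cvgS|exact: cvg_cst].
Unshelve. all: by end_near. Qed.

(** The reciprocals of (q)_n are bounded, so (q)_n cannot tend to 0. *)
Lemma qpochqq_inf_neq0 : qpoch_inf q q != 0.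
Proof.
have [B B0 BP] := qfactinv_bounded.
apply/eqP => q0; have := @qpoch_cvg q; rewrite q0 => /cvgrPdist_lt.
have B1 : 0 < B + 1 by rewrite ltr_wpDl.
move=> /(_ (B + 1)^-1); rewrite invr_gt0 => /(_ B1) [N _ /(_ N (leqnn N))] /=.
rewrite sub0r normrN => ltN; have := BP N%:Z; rewrite /= normfV.
have pN : 0 < `|qpoch q q N| by rewrite normr_gt0 qpochqq_neq0.
have ltB : B + 1 < `|qpoch q q N|^-1.
  by rewrite -[ltLHS]invrK ltf_pV2 ?posrE ?invr_gt0.
by move=> /(lt_le_trans ltB) /lt_geF; rewrite lerDl ler01.
Qed.

Lemma qfactinv_cvg z :
  ((qfactinv q (n%:Z + z) : R[i]^o) @[n --> \oo]
     --> ((qpoch_inf q q)^-1 : R[i]^o))%classic.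
Proof.
have cvgI : (((qpoch q q n)^-1 : R[i]^o) @[n --> \oo]
     --> ((qpoch_inf q q)^-1 : R[i]^o))%classic.
  by apply: cvgV; [exact: qpochqq_inf_neq0|exact: qpoch_cvg].
have abs_oo : (`|(n%:Z + z)%R|%N @[n --> \oo] --> \oo)%classic.
  move=> P [N _ NP]; exists (N + `|z|)%N => // n /= le_n.
  by apply: NP => /=; lia.
apply: cvg_trans (cvg_comp _ _ abs_oo cvgI); apply: near_eq_cvg.
near=> n; rewrite /comp.
have le_zn : (`|z| <= n)%N by near: n; exact: nbhs_infty_ge.
have -> : n%:Z + z = `|(n%:Z + z)%R|%N%:Z by lia.
by rewrite absz_nat.
Unshelve. all: by end_near. Qed.
End QPochhammerLimits.

(** * Finite index sets exhausting the ranges of summation *)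

Lemma mem_int_window L k : (k \in int_window L) = (`|k| <= L)%N.
Proof.
rewrite mem_cat; apply/orP/idP => [[] /mapP[n] | ].
- by rewrite mem_iota => lt_n ->; lia.
- by rewrite mem_iota => lt_n ->; lia.
case: k => n le_n; [left|right]; apply/mapP; exists n => //; rewrite mem_iota; lia.
Qed.

Lemma int_window_uniq L : uniq (int_window L).
Proof.
rewrite cat_uniq !map_inj_uniq ?iota_uniq /= ?andbT; try by move=> x y [].
by apply/hasPn => _ /mapP[n _ ->]; apply/negP => /mapP[].
Qed.

Lemma near_chains m (t : m.-tuple nat) :
  \forall M \near \oo%classic, t \in chains M m.
Proof.
elim: m t => [|m IHm] t; first by near=> M; rewrite tuple0 inE.
case/tupleP: t => x t; near=> M; rewrite mem_chainsS; apply/andP; split.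
  have : (x <= M)%N by near: M; exact: nbhs_infty_ge.
  by lia.
by near: M; exact: IHm.
Unshelve. all: by end_near. Qed.

(** * Letting M tend to infinity *)

Section Limits.
Variables (R : realType) (q s : R[i]).
Hypothesis q_lt1 : `|q| < 1.

Lemma chain_sum_cvg m d (f : nat -> R[i]) (w : m.+1.-tuple nat -> R[i]) :
  abs_summable w ->
  (forall t, w t = s ^+ (\sum_(1 <= i < m.+2) nidx t i ^ 2)%N
    / qpoch q q (nidx t m.+1)
    * \prod_(1 <= i < m.+1) qbinom q (nidx t i.+1 + (d == i))%N (nidx t i)
    * f (nidx t 1)) ->
  ((chain_sum q s M m.+1 d f : R[i]^o) @[M --> \oo] --> (csum w : R[i]^o))%classic.
Proof.
move=> sum_w wE; set delta : nat := (d == m.+1).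
(* This is (q)_(M+delta) / (q)_(M+delta-n_m), zero when n_m > M + delta, where n_m denotes the last
   index; it is uniformly bounded and tends to 1. *)
pose c (M : nat) (t : m.+1.-tuple nat) :=
  qpoch q q (M + delta) * qfactinv q (M%:Z + (delta%:Z - (nidx t m.+1)%:Z)).
have [B1 B10 B1P] := qpoch_bounded q_lt1 q.
have [B2 B20 B2P] := qfactinv_bounded q_lt1.
have -> : (fun M => chain_sum q s M m.+1 d f)
        = (fun M => \sum_(t <- chains M m.+1) c M t * w t).
  apply/funext => M; apply: eq_bigr => t _.
  rewrite (chain_weight_nidx (qpochqq_neq0 q_lt1)) wE qbinomE -/delta.
  have -> : head M t = nidx t 1 by case/tupleP: t.
  have := qpochqq_neq0 q_lt1 (nidx t m.+1).
  by rewrite /c PoszD addrA; move: (qfactinv _ _) => v w0; field.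
rewrite -[csum w]mul1r.
apply: (cvg_dominated_sums (K := B1 * B2)); first exact: mulr_ge0.
- exact: abs_summable_bounded_sums.
- by move=> M; exact: chains_uniq.
- exact: near_chains.
- by move=> M t; rewrite normrM ler_pM.
move=> t; rewrite -[1](divff (qpochqq_inf_neq0 q_lt1)).
apply: cvgM; last exact: qfactinv_cvg.
apply: cvg_comp (@qpoch_cvg _ _ q_lt1 q).
exact: cvg_addnr.
Qed.

Lemma bilateral_sum_cvg (f : int -> R[i]) (L : nat -> nat) :
  abs_summable f -> (forall M, M < L M)%N ->
  ((\sum_(n <- [seq k - 1 | k <- int_window (L M)])
      qpoch q (- s) M * qpoch q q M * bailey_kernel q M n * f n : R[i]^o)
    @[M --> \oo]
    --> (qpoch_inf q (- s) / qpoch_inf q q * csum f : R[i]^o))%classic.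
Proof.
move=> sum_f ltL.
have [B0 B00 B0P] := qpoch_bounded q_lt1 (- s).
have [B1 B10 B1P] := qpoch_bounded q_lt1 q.
have [B2 B20 B2P] := qfactinv_bounded q_lt1.
apply: (cvg_dominated_sums (K := B0 * B1 * (B2 * B2))); first by rewrite !mulr_ge0.
- exact: abs_summable_bounded_sums.
- by move=> M; rewrite map_inj_uniq ?int_window_uniq //; exact: addIr.
(* The translated window contains n once |n + 1| <= L M, which follows from |n| <= M < L M. *)
- move=> n; near=> M; apply/mapP; exists (n + 1); last by rewrite addrK.
  have : (`|n| <= M)%N by near: M; exact: nbhs_infty_ge.
  by have := ltL M; rewrite mem_int_window; lia.
- by move=> M n; rewrite !normrM !ler_pM ?mulr_ge0.
move=> n; have q0 := qpochqq_inf_neq0 q_lt1.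
have -> : qpoch_inf q (- s) / qpoch_inf q q
  = qpoch_inf q (- s) * qpoch_inf q q * ((qpoch_inf q q)^-1 * (qpoch_inf q q)^-1).
  by field.
by apply: cvgM; apply: cvgM; first [exact: (@qpoch_cvg _ _ q_lt1)
                                   | exact: (@qfactinv_cvg _ _ q_lt1)].
Unshelve. all: by end_near. Qed.
End Limits.

Theorem theorem1p6 (R : realType) (q s : R[i])
    (q_bounds : 0 < `|q| < 1) (s_sqrt : s ^+ 2 = q)
    (alpha beta : nat -> R[i]) (g : int -> R[i])
    (bailey : bailey_pair q 1 alpha beta)
    (g0 : g 0 = 1)
    (alphaE : forall n : nat,
       alpha n = if n == 0%N then 1 else (1 + q ^+ n) * g n%:Z)
    (gN : forall n : int, g (- n) = q ^ n * g n)
    (m a : nat) (a_bounds : (1 <= a <= m)%N)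
    (sum1_cvg : abs_summable (summand1 q s beta (m := m) a))
    (sum2_cvg : abs_summable (summand2 q s beta (m := m) a))
    (sum3_cvg : abs_summable (summand3 s g m a)) :
  csum (summand1 q s beta (m := m) a) - csum (summand2 q s beta (m := m) a)
  = - s ^+ (a - 1) * (qpoch_inf q (- s) / qpoch_inf q q)
       * csum (summand3 s g m a).
Proof.
have /andP[q_gt0 q_lt1] := q_bounds.
have q0 : q != 0 by rewrite -normr_gt0.
have s0 : s != 0 by apply: contraNneq q0 => s0; rewrite -s_sqrt s0 expr0n.
have [d da] : exists d, a = d.+1 by exists a.-1; lia.
have [e dm] : exists e, m = (e + d.+1)%N by exists (m - a)%N; lia.
have [m' dm'] : exists m', m = m'.+1 by exists m.-1; lia.
have FI M := finite_identity q0 (qpochqq_neq0 q_lt1) s_sqrt s0 bailey g0 alphaE gN M e d.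
rewrite -dm in FI; move=> {dm}; subst m a.
have cvg1 := chain_sum_cvg (s := s) q_lt1 (d := d.+1)
  (f := fun n => qpoch q (- s) n * qpoch q q n * beta n) sum1_cvg.
have cvg2 := chain_sum_cvg (s := s) q_lt1 (d := d) (f := fun n =>
  qpoch q (- s) (n + (d == 0))%N * qpoch q q (n + (d == 0))%N * beta (n + (d == 0))%N) sum2_cvg.
have cvg3 : ((- s ^+ d * \sum_(n <- [seq k - 1 | k <- int_window (M + m'.+1).+1])
    (qpoch q (- s) M * qpoch q q M * bailey_kernel q M n * summand3 s g m'.+1 d.+1 n)
    : R[i]^o) @[M --> \oo]
  --> (- s ^+ d * (qpoch_inf q (- s) / qpoch_inf q q * csum (summand3 s g m'.+1 d.+1))
    : R[i]^o))%classic.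
  apply: cvgMl_tmp; apply: (bilateral_sum_cvg q_lt1 (L := fun M => (M + m'.+1).+1)) => // M.
  by lia.
(* By the finite identity, both sides are limits of the same sequence in M. *)
rewrite subn1 /= -mulrA; apply: (@cvg_unique R[i]^o (@norm_hausdorff _ _) _ _ _ _ _ cvg3).
rewrite -(funext FI).
apply: cvgB; [apply: cvg1|apply: cvg2] => t.
  by rewrite /summand1; ring.
by rewrite /summand2 subn1 /=; ring.
Qed.
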